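(* Let $d\ge2$, $L\ge2$, let $q=(q_0,\ldots,q_{d-1})$ be a probability distribution, and suppose $\mathcal{B}^{(\alpha)}=\{|e_j^{(\alpha)}\rangle\}_{j=0}^{d-1}$, $\alpha=1,\ldots,L$, is a set of $L$ mutually equibiased bases (MEBs) associated with $q$ in a $d$-dimensional Hilbert space $\mathcal{H}$. Assume that $\lambda_{\max}(N)<1/(L-1)$. Let $\varrho$ be an arbitrary quantum state (density matrix) on $\mathcal{H}$ and let $p_j^{(\alpha)}=\mathrm{Tr}[\varrho P_j^{(\alpha)}]$, where $P_j^{(\alpha)}=|e_j^{(\alpha)}\rangle\langle e_j^{(\alpha)}|$. Then $$\sum_{\alpha=1}^{L}\sum_{j=0}^{d-1}\big[p_j^{(\alpha)}\big]^2\le f_L(q)\Big[\mathrm{Tr}[\varrho^2]-\frac1d\Big]+\frac{L}{d},\qquad f_L(q)=1+(L-1)\lambda_{\max}(N).$$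
   Context: Mutually equibiased bases: let $\mathcal{H}$ be a $d$-dimensional complex Hilbert space and $q=(q_0,\ldots,q_{d-1})$ a probability distribution. A set of $L$ orthonormal bases $\mathcal{B}^{(\alpha)}=\{|e_k^{(\alpha)}\rangle\}_{k=0}^{d-1}$, $\alpha=1,\ldots,L$, of $\mathcal{H}$ is called a set of mutually equibiased bases (MEBs) associated with $q$ if for every pair $\alpha\neq\beta$ there is a permutation $\sigma$ of $\{0,1,\ldots,d-1\}$ (which may depend on the pair $(\alpha,\beta)$) such that $$\mathrm{Tr}\big[P_k^{(\alpha)}P_l^{(\beta)}\big]=q_{\sigma(k)\oplus\sigma(l)}\qquad\text{for all }k,l\in\{0,\ldots,d-1\},$$ where $P_k^{(\alpha)}=|e_k^{(\alpha)}\rangle\langle e_k^{(\alpha)}|$ and $\oplus$ denotes addition modulo $d$. By convention $\mathcal{B}^{(1)}$ is the standard (computational) basis, and $\sigma$ is taken to be the identity when one of the two bases is the standard basis. The matrix $N$: $N$ is the $(d-1)\times(d-1)$ Hermitian matrix (indices $1,\ldots,d-1$) whose only nonzero entries are on the antidiagonal, $N_{k,d-k}=\sum_{m=0}^{d-1}\omega^{-km}q_m$ for $k=1,\ldots,d-1$, with $\omega=e^{2\pi i/d}$. Define $\lambda_{\max}(N)=\max_k|N_{k,d-k}|$, the maximum taken over $k\in\{1,\ldots,(d-1)/2\}$ if $d$ is odd and over $k\in\{1,\ldots,d/2\}$ if $d$ is even. *)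

(* Defs.v *)
From HB Require Import structures.
From mathcomp Require Import all_boot all_order all_fingroup all_algebra.
From mathcomp Require Import sesquilinear spectral.
From mathcomp.real_closed Require Import complex.
From mathcomp Require Import reals trigo.

Set Implicit Arguments.
Unset Strict Implicit.
Unset Printing Implicit Defensive.

Import Order.TTheory GRing.Theory Num.Theory.

Local Open Scope ring_scope.
Local Open Scope complex_scope.
Local Open Scope sesquilinear_scope.

Definition prob_dist (R : realType) (d : nat) (q : 'I_d -> R) : Prop :=
  (forall k, 0 <= q k) /\ \sum_(k < d) q k = 1.

(* 'I_d carries no additive structure for a variable d, hence this direct
   definition of addition modulo d. *)
Definition ord_addm (d : nat) (k l : 'I_d) : 'I_d :=
  Ordinal (ltn_pmod (k + l) (leq_ltn_trans (leq0n k) (ltn_ord k))).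

(* Hilbert space is C^d with kets as column vectors and
   <u|v> = (u^t* *m v) 0 0. *)
Definition orthonormal_basis (R : realType) (d : nat)
    (e : 'I_d -> 'cV[R[i]]_d) : Prop :=
  basis_of fullv [seq e k | k : 'I_d] /\
  (forall k l : 'I_d, ((e k)^t* *m e l) 0 0 = (k == l)%:R).

Definition std_basis (R : realType) (d : nat) (k : 'I_d) : 'cV[R[i]]_d :=
  delta_mx k 0.

Definition ketbra (R : realType) (d : nat) (v : 'cV[R[i]]_d) : 'M[R[i]]_d :=
  v *m v^t*.

Definition density (R : realType) (d : nat) (rho : 'M[R[i]]_d) : Prop :=
  [/\ rho \is hermsymmx,
      (forall v : 'cV[R[i]]_d, 0 <= (v^t* *m rho *m v) 0 0)
    & \tr rho = 1].

(* The bases are indexed from 0: the basis of index 0 is the first one, which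
   is by convention the standard basis. *)
Definition mutually_equibiased (R : realType) (d L : nat) (q : 'I_d -> R)
    (B : 'I_L -> 'I_d -> 'cV[R[i]]_d) : Prop :=
  [/\ forall a, orthonormal_basis (B a),
      forall a : 'I_L, a = 0%N :> nat -> B a =1 @std_basis R d
    & forall a b : 'I_L, a != b ->
      exists s : 'S_d,
        (B a =1 @std_basis R d \/ B b =1 @std_basis R d -> s = 1%g) /\
        (forall k l : 'I_d, \tr (ketbra (B a k) *m ketbra (B b l)) =
                            (q (ord_addm (s k) (s l)))%:C)].

(* e^(2 pi i / d) *)
Definition omega (R : realType) (d : nat) : R[i] :=
  cos (2 * pi / d%:R) +i* sin (2 * pi / d%:R).

(* Row and column indices run over 1, ..., d-1, so that the ordinal i stands
   for the index i.+1. *)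
Definition Nmx (R : realType) (d : nat) (q : 'I_d -> R) : 'M[R[i]]_(d.-1) :=
  \matrix_(i, j) (if (i.+1 + j.+1 == d)%N
                  then \sum_(m < d) omega R d ^- (i.+1 * m) * (q m)%:C
                  else 0).

(* The ordinal k stands for the index k.+1, and rev_ord k for d - k.+1.
   As d./2 is (d-1)/2 for d odd and d/2 for d even, the range is the intended
   one in both cases; it is nonempty for d >= 2, and the moduli are
   nonnegative, so the neutral element 0 is harmless. *)
Definition lambda_max (R : realType) (d : nat) (q : 'I_d -> R) : R :=
  \big[Num.max/0]_(k < d.-1 | (k.+1 <= d./2)%N)
     Normc.normc (Nmx q k (rev_ord k)).

Definition f_L (R : realType) (d L : nat) (q : 'I_d -> R) : R :=
  1 + (L%:R - 1) * lambda_max q.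

Definition outcome_prob (R : realType) (d : nat) (rho : 'M[R[i]]_d)
    (v : 'cV[R[i]]_d) : R[i] :=
  \tr (rho *m ketbra v).

(* Main.v *)
(* Put x_aj = tr (M P_aj) with M = rho - 1/d; these are the centered outcome
   probabilities.  For two distinct bases the Gram matrix tr (P_aj P_bl) is, up
   to a simultaneous permutation of rows and columns, the Hankel matrix q_(k+l)
   with indices mod d.  The discrete Fourier transform shows that on centered
   vectors the form it defines is bounded by lambda_max (|x_a|^2 + |x_b|^2) / 2.
   Summing over pairs of bases, the Gram form of all the P_aj is at most
   f_L |x|^2, and a Bessel-type inequality then gives |x|^2 <= f_L tr (M^2). *)
Require Import Defs.
From HB Require Import structures.
From mathcomp Require Import all_boot all_order all_fingroup all_algebra.
From mathcomp Require Import sesquilinear spectral.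
From mathcomp.real_closed Require Import complex.
From mathcomp Require Import reals trigo.
From mathcomp Require Import zify ring lra.

Set Implicit Arguments.
Unset Strict Implicit.
Unset Printing Implicit Defensive.

Import Order.TTheory GRing.Theory Num.Theory.

Local Open Scope ring_scope.
Local Open Scope complex_scope.
Local Open Scope sesquilinear_scope.

(** * Roots of unity and the discrete Fourier transform *)

Lemma sum_prim_root (F : fieldType) (n : nat) (z : F) (i j : nat) :
  n.-primitive_root z ->
  \sum_(k < n) z ^+ (k * i) / z ^+ (k * j) = (i == j %[mod n])%:R * n%:R.
Proof.
move=> zP; have nz m : z ^+ m != 0.
  by rewrite expf_neq0 // (prim_root_eq0 zP) -lt0n (prim_order_gt0 zP).
rewrite -(eq_prim_root_expr zP).
under eq_bigr => k _ do rewrite ![(k * _)%N]mulnC !exprM -exprVn -exprMn.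
case: eqP => [-> | /eqP neq].
  rewrite mul1r divff //.
  by under eq_bigr do rewrite expr1n; rewrite sumr_const card_ord.
(* When the two powers differ, multiplying the geometric sum by its ratio minus 1 telescopes it to
   0. *)
rewrite mul0r; apply/(mulfI (_ : z ^+ i / z ^+ j - 1 != 0)).
  by rewrite subr_eq0; apply: contra neq => /eqP/divr1_eq ->.
rewrite -subrX1 mulr0 exprMn exprVn -!exprM [(i * n)%N]mulnC [(j * n)%N]mulnC !exprM.
by rewrite (prim_expr_order zP) !expr1n divr1 subrr.
Qed.

Lemma prim_root_conj (C : numClosedFieldType) (n : nat) (z : C) :
  n.-primitive_root z -> Num.conj z = z^-1.
Proof.
move=> zP; suff z1 : `|z| = 1 by rewrite invC_norm z1 expr1n invr1 mul1r.
apply/eqP; rewrite -(@pexpr_eq1 _ _ n) ?normr_ge0 ?(prim_order_gt0 zP) //.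
by rewrite -normrX (prim_expr_order zP) normr1.
Qed.

Lemma parseval (C : numClosedFieldType) (n : nat) (z : C) (x : 'I_n -> C) :
  n.-primitive_root z ->
  \sum_(j < n) `|\sum_(k < n) z ^+ (j * k) * x k| ^+ 2 =
    n%:R * \sum_(k < n) `|x k| ^+ 2.
Proof.
move=> zP.
under eq_bigr => j _.
  rewrite normCK rmorph_sum mulr_suml.
  under eq_bigr => k _.
    rewrite mulr_sumr.
    under eq_bigr => l _.
      rewrite rmorphM rmorphXn /= (prim_root_conj zP) exprVn mulrACA.
      over.
    over.
  over.
rewrite exchange_big mulr_sumr; apply: eq_bigr => k _ /=.
rewrite exchange_big (bigD1 k) //= [X in _ + X]big1 => [|l nlk].
  by rewrite -mulr_suml (sum_prim_root _ _ zP) eqxx mul1r addr0 normCK.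
rewrite -mulr_suml (sum_prim_root _ _ zP) !modn_small //.
by rewrite eq_sym (negPf nlk : (l == k :> nat) = false) !mul0r.
Qed.

(** Fourier inversion expands [q (ord_addm k l)] in the characters [z ^+ (j * (k + l))]. Each
    factors as [z ^+ (j * k)] times [z ^+ (j * l)], so the form becomes diagonal in the modes [j],
    with the transform of [q] as coefficients. *)
Lemma hankel_fourier (C : numClosedFieldType) (n : nat) (z : C)
    (q x y : 'I_n -> C) :
  n.-primitive_root z ->
  n%:R * \sum_(k < n) \sum_(l < n) q (ord_addm k l) * (x k * y l) =
    \sum_(j < n) (\sum_(m < n) z ^- (j * m) * q m) *
      ((\sum_(k < n) z ^+ (j * k) * x k) * (\sum_(l < n) z ^+ (j * l) * y l)).
Proof.
move=> zP.
have qE k l : n%:R * q (ord_addm k l) =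
    \sum_(j < n) (\sum_(m < n) z ^- (j * m) * q m) * z ^+ (j * (k + l)).
  under eq_bigr do rewrite mulr_suml.
  rewrite exchange_big (bigD1 (ord_addm k l)) //= [X in _ + X]big1 => [|m nm].
    under eq_bigr do rewrite mulrAC [_^-1 * _]mulrC.
    by rewrite -mulr_suml (sum_prim_root _ _ zP) /= modn_mod eqxx mul1r addr0.
  under eq_bigr do rewrite mulrAC [_^-1 * _]mulrC.
  rewrite -mulr_suml (sum_prim_root _ _ zP) [(m %% n)%N]modn_small //.
  by rewrite eq_sym (negPf nm : (m == _ :> nat) = false) !mul0r.
rewrite mulr_sumr.
under eq_bigr => k _.
  rewrite mulr_sumr.
  under eq_bigr do rewrite mulrA qE mulr_suml.
  rewrite exchange_big; over.
rewrite exchange_big; apply: eq_bigr => j _ /=.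
rewrite [X in _ = _ * X]mulr_suml [RHS]mulr_sumr; apply: eq_bigr => k _.
rewrite [X in _ = _ * X]mulr_sumr [RHS]mulr_sumr; apply: eq_bigr => l _.
by rewrite mulnDr exprD -[LHS]mulrA mulrACA.
Qed.

(* Centering kills the Fourier mode at 0, so only the modes bounded by [lam]
   contribute. *)
Lemma hankel_bound (C : numClosedFieldType) (n : nat) (z lam : C)
    (q x y : 'I_n -> C) :
  n.-primitive_root z -> 0 <= lam ->
  (forall j, (0 < j < n)%N -> `|\sum_(m < n) z ^- (j * m) * q m| <= lam) ->
  \sum_(k < n) x k = 0 ->
  `|\sum_(k < n) \sum_(l < n) q (ord_addm k l) * (x k * y l)| <=
    lam / 2 * (\sum_(k < n) `|x k| ^+ 2 + \sum_(l < n) `|y l| ^+ 2).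
Proof.
move=> zP lam0 lamP x0; have n0 : 0 < n%:R :> C by rewrite ltr0n (prim_order_gt0 zP).
rewrite -(ler_pM2l n0) -[X in X * `|_|](normr_nat C n) -normrM.
rewrite (hankel_fourier _ _ _ zP).
rewrite mulrCA mulrDr -!(parseval _ zP) -big_split mulr_sumr /=.
apply: le_trans (ler_norm_sum _ _ _) _; apply: ler_sum => j _.
have [j0|j0] := eqVneq (j : nat) 0%N.
  under [X in _ * (X * _)]eq_bigr do rewrite j0 mul0n mul1r.
  rewrite x0 mul0r mulr0 normr0 mulr_ge0 ?addr_ge0 ?exprn_ge0 //.
  by rewrite mulr_ge0 // invr_ge0 ler0n.
set X := \sum_(k < n) _ * x k; set Y := \sum_(l < n) _ * y l.
rewrite normrM -mulrA ler_pM ?lamP ?lt0n ?j0 //= normrM.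
(* What remains is the inequality of arithmetic and geometric means for [|X|] and [|Y|]. *)
rewrite ler_pdivlMl ?ltr0n // -subr_ge0.
have -> : `|X| ^+ 2 + `|Y| ^+ 2 - 2 * (`|X| * `|Y|) = (`|X| - `|Y|) ^+ 2.
  by rewrite sqrrB mulr_natl addrAC.
by rewrite real_exprn_even_ge0 // rpredB ?normr_real.
Qed.

(** * The root [omega] and the Fourier coefficients of [q] *)

Lemma omegaX (R : realType) (d n : nat) :
  omega R d ^+ n =
    cos (n%:R * (2 * pi / d%:R)) +i* sin (n%:R * (2 * pi / d%:R)).
Proof.
elim: n => [|n IH]; first by rewrite expr0 mul0r cos0 sin0.
rewrite exprS IH -[n.+1%:R]natr1 (mulrDl n%:R) mul1r cosD sinD /omega.
by apply/eqP; rewrite eq_complex /=; apply/andP; split; apply/eqP; ring.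
Qed.

Lemma omega_prim (R : realType) (d : nat) :
  (0 < d)%N -> d.-primitive_root (omega R d).
Proof.
move=> d0; have dn0 : d%:R != 0 :> R by rewrite pnatr_eq0 -lt0n.
rewrite /primitive_root_of_unity d0; apply/forallP => i.
rewrite unity_rootE omegaX; apply/eqP; apply/eqP/eqP => [[cos1 _]|].
  apply/eqP; rewrite eqn_leq ltn_ord leqNgt; apply/negP => ltid.
  (* Half of the angle: as [i.+1 < d], it lies strictly between 0 and pi, so cos (2 phi) = 1 - 2
     sin(phi)^2 < 1. *)
  set phi := i.+1%:R * pi / d%:R : R.
  have phiE : i.+1%:R * (2 * pi / d%:R) = phi *+ 2.
    by rewrite /phi -mulr_natl; ring.
  have : 0 < phi < pi.
    rewrite /phi divr_gt0 ?mulr_gt0 ?pi_gt0 ?ltr0n //=.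
    by rewrite ltr_pdivrMr ?ltr0n // mulrC ltr_pM2l ?pi_gt0 // ltr_nat.
  move=> /sin_gt0_pi sin0; move: cos1; rewrite phiE cos_mulr2n cos2sin2.
  by have := exprn_gt0 2 sin0; lra.
by move=> ->; rewrite mulrCA divff // mulr1 mulr_natl cos2pi sin2pi.
Qed.

(** [lambda_max] only inspects indices up to [d./2]; the reflection of [j] to [d - j] preserves the
    modulus and extends the bound to all nonzero modes. *)
Lemma norm_Nmx_le (R : realType) (d : nat) (q : 'I_d -> R) (j : nat) :
  (0 < j < d)%N ->
  `|\sum_(m < d) omega R d ^- (j * m) * (q m)%:C| <= (lambda_max q)%:C.
Proof.
have low k : (0 < k <= d./2)%N -> (k < d)%N ->
    `|\sum_(m < d) omega R d ^- (k * m) * (q m)%:C| <= (lambda_max q)%:C.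
  case: k => // k kd2 kd.
  have kd' : (k < d.-1)%N by case: (d) kd.
  have := @le_bigmax_cond _ _ _ 0 (Ordinal kd') (fun i => (i.+1 <= d./2)%N)
    (fun i => Normc.normc (Nmx q i (rev_ord i))) kd2.
  rewrite -lecR; apply: le_trans.
  rewrite mxE /= ifT //.
  by case: (d) kd => // d' kd; rewrite /= subnSK // addSn subnKC // ltnW.
case/andP=> j0 jd; have [jd2|d2j] := leqP j d./2.
  by apply: low; rewrite ?j0.
have djd : (d - j < d)%N by rewrite ltn_subrL j0 (leq_ltn_trans _ jd).
apply: le_trans (low (d - j)%N _ djd); last first.
  by rewrite subn_gt0 jd /= leq_subLR; lia.
have wP := omega_prim R (leq_ltn_trans (leq0n j) jd).
(* As q is real, its Fourier coefficients at j and d - j are conjugate. *)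
rewrite -norm_conjC rmorph_sum.
rewrite le_eqVlt; apply/orP; left; apply/eqP; congr `|_|.
apply: eq_bigr => m _.
rewrite rmorphM fmorphV rmorphXn /= (prim_root_conj wP).
rewrite (conjc_real (q m) : Num.conj _ = _); congr (_ * _).
have nz : omega R d ^+ ((d - j) * m) != 0.
  by rewrite expf_neq0 // (prim_root_eq0 wP) -lt0n (prim_order_gt0 wP).
rewrite exprVn invrK; apply: (mulIf nz); rewrite mulVf //.
by rewrite -exprD -mulnDl subnKC 1?ltnW // exprM (prim_expr_order wP) expr1n.
Qed.

(** * The trace form on Hermitian matrices *)

Lemma trmxC_mul (C : numClosedFieldType) (m p r : nat)
    (A : 'M[C]_(m, p)) (B : 'M[C]_(p, r)) :
  (A *m B)^t* = B^t* *m A^t*.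
Proof. by rewrite trmx_mul map_mxM. Qed.

Lemma mxtrace_sqr_herm_ge0 (C : numClosedFieldType) (n : nat)
    (M : 'M[C]_n) : M^t* = M -> 0 <= \tr (M *m M).
Proof.
move=> hM; rewrite -{2}hM; apply: sumr_ge0 => i _; rewrite mxE.
by apply: sumr_ge0 => j _; rewrite !mxE mul_conjC_ge0.
Qed.

Lemma mxtrace_herm_real (C : numClosedFieldType) (n : nat)
    (A B : 'M[C]_n) :
  A^t* = A -> B^t* = B -> \tr (A *m B) \is Num.real.
Proof.
move=> hA hB; apply/CrealP.
by rewrite -trace_map_mx -mxtrace_tr map_trmx trmxC_mul hA hB mxtrace_mulC.
Qed.

(* The bound on the Gram form bounds the norm of the synthesis operator, hence
   also of its adjoint, the analysis operator: expand
   0 <= tr ((f M - sum_i x_i P_i) ^ 2). *)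
Lemma bessel_herm (C : numClosedFieldType) (n : nat) (I : finType)
    (P : I -> 'M[C]_n) (M : 'M[C]_n) (f : C)
    (x := fun i => \tr (M *m P i)) :
  M^t* = M -> (forall i, (P i)^t* = P i) -> 0 < f ->
  \sum_i \sum_j \tr (P i *m P j) * (x i * x j) <= f * \sum_i x i ^+ 2 ->
  \sum_i x i ^+ 2 <= f * \tr (M *m M).
Proof.
move=> hM hP f0 gram; have xr i : x i \is Num.real by apply: mxtrace_herm_real.
pose T := \sum_i x i *: P i; set S := \sum_i x i ^+ 2 in gram *.
have hT : T^t* = T.
  rewrite /T linear_sum /= map_mx_sum /=; apply: eq_bigr => i _.
  by rewrite linearZ /= map_mxZ hP /= (CrealP (xr i)).
have MT : \tr (M *m T) = S.
  rewrite mulmx_sumr linear_sum; apply: eq_bigr => i _ /=.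
  by rewrite -scalemxAr mxtraceZ.
have TT : \tr (T *m T) = \sum_i \sum_j \tr (P i *m P j) * (x i * x j).
  rewrite {1}/T mulmx_suml linear_sum; apply: eq_bigr => i _ /=.
  rewrite mulmx_sumr linear_sum; apply: eq_bigr => j _ /=.
  by rewrite -scalemxAl -scalemxAr !mxtraceZ mulrA mulrC.
have := @mxtrace_sqr_herm_ge0 _ _ (f *: M - T).
rewrite linearB /= map_mxB linearZ /= map_mxZ hM hT /=.
rewrite (CrealP (gtr0_real f0)) => /(_ erefl).
rewrite mulmxBl !mulmxBr !linearB /= -!scalemxAl -!scalemxAr !mxtraceZ.
rewrite [\tr (T *m M)]mxtrace_mulC MT TT => sq.
(* The expanded square is f^2 tr(M^2) - 2 f S + tr(T^2). By [gram], tr(T^2) is at most f S, which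
   leaves 0 <= f (f tr(M^2) - S). *)
rewrite -(ler_pM2l f0) -subr_ge0; apply: le_trans sq _.
by rewrite -subr_ge0; move: gram; rewrite -subr_ge0; congr (0 <= _); ring.
Qed.

(** * Rank-one projectors and the Gram form of the bases *)

Lemma mxtrace_ketbra2 (C : numClosedFieldType) (n : nat)
    (u v : 'cV[C]_n) :
  \tr (u *m u^t* *m (v *m v^t*)) = (u^t* *m v) 0 0 * (v^t* *m u) 0 0.
Proof.
rewrite -mulmxA mxtrace_mulC !mulmxA -[_ *m v *m _ *m _]mulmxA.
by rewrite trace_mx11 mxE big_ord1.
Qed.

Lemma sum_ketbra_orthonormal (C : numClosedFieldType) (n : nat)
    (e : 'I_n -> 'cV[C]_n) :
  (forall k l, ((e k)^t* *m e l) 0 0 = (k == l)%:R) ->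
  \sum_k e k *m (e k)^t* = 1%:M.
Proof.
move=> on; pose U := \matrix_(i, k) e k i 0.
(* A left inverse of a square matrix is also a right inverse, so orthonormality yields
   completeness. *)
have /mulmx1C UU : U^t* *m U = 1%:M.
  apply/matrixP => k l; rewrite [RHS]mxE -on !mxE.
  by apply: eq_bigr => i _; rewrite !mxE.
rewrite -UU; apply/matrixP => i j; rewrite summxE mxE.
by apply: eq_bigr => k _; rewrite !mxE big_ord1 !mxE.
Qed.

(** Orthonormality makes each diagonal block equal to [S a], and [hankel_bound] controls the others.
    Each [S a] enters 2 (L - 1) ordered pairs with weight [lam / 2], whence the factor 1 + (L - 1)
    [lam]. *)
Lemma meb_gram_le (R : realType) (d L : nat) (q : 'I_d -> R)
    (B : 'I_L -> 'I_d -> 'cV[R[i]]_d) (x : 'I_L -> 'I_d -> R[i]) :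
  (2 <= d)%N -> mutually_equibiased q B ->
  (forall a j, x a j \is Num.real) -> (forall a, \sum_(j < d) x a j = 0) ->
  \sum_(a < L) \sum_(j < d) \sum_(b < L) \sum_(l < d)
      \tr (ketbra (B a j) *m ketbra (B b l)) * (x a j * x b l)
    <= (f_L L q)%:C * \sum_(a < L) \sum_(j < d) x a j ^+ 2.
Proof.
move=> d2 [hon _ heq] xr x0; set lam : R[i] := (lambda_max q)%:C.
have wP : d.-primitive_root (omega R d) by apply: omega_prim; apply: ltnW.
pose S a := \sum_(j < d) x a j ^+ 2.
pose G a b := \sum_(j < d) \sum_(l < d)
  \tr (ketbra (B a j) *m ketbra (B b l)) * (x a j * x b l).
have Gdiag a : G a a = S a.
  apply: eq_bigr => j _; have [_ on] := hon a.
  rewrite (bigD1 j) //= big1 => [|l nlj]; rewrite mxtrace_ketbra2 !on.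
    by rewrite !eqxx !mul1r addr0.
  by rewrite (negPf nlj) mulr0 mul0r.
have Goff a b : a != b -> G a b <= lam / 2 * (S a + S b).
  move=> /heq[s [_ qE]].
  (* The same [s] acts on rows and columns, so it can be moved onto the vectors; this changes
     neither their sums nor their norms. *)
  have Gq : G a b = \sum_(k < d) \sum_(l < d) (q (ord_addm k l))%:C *
      (x a ((s^-1)%g k) * x b ((s^-1)%g l)).
    rewrite [RHS](reindex_inj (@perm_inj _ s)) /=; apply: eq_bigr => k _.
    rewrite [RHS](reindex_inj (@perm_inj _ s)) /=; apply: eq_bigr => l _.
    by rewrite qE !permK.
  have SE c : S c = \sum_(k < d) `|x c ((s^-1)%g k)| ^+ 2.
    rewrite /S (reindex_inj (@perm_inj _ (s^-1)%g)) /=; apply: eq_bigr => k _.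
    by rewrite real_normK.
  rewrite Gq !SE; apply: le_trans (real_ler_norm _) _.
    apply: rpred_sum => k _; apply: rpred_sum => l _.
    by rewrite rpredM ?rpredM // complex_real.
  apply: (@hankel_bound _ _ _ lam (fun m => (q m)%:C)
    (fun k => x a ((s^-1)%g k)) (fun l => x b ((s^-1)%g l)) wP) => [|j jd|].
  - by rewrite ler0c; apply: bigmax_ge_id.
  - exact: norm_Nmx_le.
  - by rewrite -[RHS](x0 a) [RHS](reindex_inj (@perm_inj _ (s^-1)%g)).
under eq_bigr => a _ do rewrite exchange_big.
apply: (@le_trans _ _
  (\sum_(a < L) (S a + \sum_(b < L | b != a) lam / 2 * (S a + S b)))).
  apply: ler_sum => a _; rewrite (bigD1 a) //= -/(G a a) Gdiag lerD2l.
  by apply: ler_sum => b nab; apply: Goff; rewrite eq_sym.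
have -> : (f_L L q)%:C = 1 + (L%:R - 1) * lam.
  by rewrite /f_L rmorphD rmorphM rmorphB rmorph1 rmorph_nat.
(* The coefficient L - 2 arises because the omitted term [b = a] is [S a + S a]. *)
have sumE a : \sum_(b < L | b != a) lam / 2 * (S a + S b) =
    lam / 2 * ((L%:R - 2) * S a + \sum_(b < L) S b).
  rewrite -mulr_sumr; congr (_ * _).
  have : \sum_(b < L) (S a + S b) = L%:R * S a + \sum_(b < L) S b.
    by rewrite big_split /= sumr_const card_ord mulr_natl.
  rewrite (bigD1 a) //= => E.
  by rewrite -(addKr (S a + S a) (\sum_(b < L | _) _)) E; ring.
under eq_bigr do rewrite sumE.
rewrite big_split /= -mulr_sumr big_split /= -mulr_sumr sumr_const card_ord.
by rewrite -mulr_natl le_eqVlt; apply/orP; left; apply/eqP; field.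
Qed.

(* The inequality is in the order of R[i], where x <= y means that y - x is
   real and nonnegative; all traces involved are real. *)
Theorem theorem4 (R : realType) (d L : nat) (q : 'I_d -> R)
    (B : 'I_L -> 'I_d -> 'cV[R[i]]_d)
    (hd : (2 <= d)%N) (hL : (2 <= L)%N)
    (hq : prob_dist q)
    (hB : mutually_equibiased q B)
    (hlambda : lambda_max q < 1 / (L%:R - 1))
    (rho : 'M[R[i]]_d) (hrho : density rho) :
  \sum_(a < L) \sum_(j < d) outcome_prob rho (B a j) ^+ 2
    <= (f_L L q)%:C * (\tr (rho *m rho) - 1 / d%:R) + L%:R / d%:R.
Proof.
case: hrho => rhoH _ rhoT; have [hon _ _] := hB.
have nzd : d%:R != 0 :> R[i] by rewrite pnatr_eq0 -lt0n ltnW.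
have rhoh : rho^t* = rho.
  by move: rhoH; rewrite is_hermitianmxE expr0 scale1r => /eqP {2}->.
(* The traceless part of [rho]; each projector has trace 1, so outcome probabilities shift by
   exactly 1/d. *)
pose M := rho - (d%:R^-1)%:M.
have hM : M^t* = M.
  rewrite /M linearB /= map_mxB rhoh tr_scalar_mx map_scalar_mx /=.
  by rewrite fmorphV rmorph_nat.
have hP a j : (ketbra (B a j))^t* = ketbra (B a j).
  by rewrite /ketbra trmxC_mul trmxCK.
pose x a j := \tr (M *m ketbra (B a j)).
have xE a j : outcome_prob rho (B a j) = x a j + d%:R^-1.
  rewrite /x /M mulmxBl mul_scalar_mx linearB /= mxtraceZ.
  have -> : \tr (ketbra (B a j)) = 1.
    by rewrite /ketbra mxtrace_mulC trace_mx11; have [_ ->] := hon a;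
       rewrite eqxx.
  by rewrite mulr1 subrK.
have trM : \tr M = 0.
  by rewrite /M linearB /= rhoT mxtrace_scalar -[_ *+ d]mulr_natl divff ?subrr.
have x0 a : \sum_(j < d) x a j = 0.
  have [_ on] := hon a.
  by rewrite -linear_sum -mulmx_sumr /= sum_ketbra_orthonormal // mulmx1.
have MM : \tr (M *m M) = \tr (rho *m rho) - 1 / d%:R.
  rewrite {2}/M mulmxBr linearB /= mul_mx_scalar mxtraceZ trM mulr0 subr0.
  by rewrite /M mulmxBl linearB /= mul_scalar_mx mxtraceZ rhoT mulr1 div1r.
have f0 : 0 < (f_L L q)%:C :> R[i].
  rewrite ltcR ltr_pwDl // mulr_ge0 ?bigmax_ge_id //.
  by rewrite subr_ge0 ler1n ltnW.
have xr a j : x a j \is Num.real by apply: mxtrace_herm_real.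
have -> : \sum_(a < L) \sum_(j < d) outcome_prob rho (B a j) ^+ 2 =
    \sum_(a < L) \sum_(j < d) x a j ^+ 2 + L%:R / d%:R.
  (* In each basis the cross terms vanish by [x0], and the d constants 1/d^2 add up to 1/d. *)
  rewrite -[L in L%:R]card_ord mulr_natl -sumr_const -big_split /=.
  apply: eq_bigr => a _.
  under eq_bigr do rewrite xE sqrrD.
  rewrite !big_split /=.
  rewrite -mulr_suml x0 mul0r !addr0.
  by congr (_ + _); rewrite sumr_const card_ord -mulr_natl; field.
rewrite lerD2r -MM pair_big /=.
(* The family is indexed by the pairs of a basis and a vector in it. *)
apply: (@bessel_herm _ _ _ (fun p => ketbra (B p.1 p.2))) => //.
have := meb_gram_le hd hB xr x0.
under eq_bigr do under eq_bigr do rewrite pair_bigA.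
by rewrite !pair_bigA.
Qed.
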